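(* Let $\Pi_n$ be a Gibbs partition of $[n]$ with weights $(w_j)$ and $(v_{n,k})$. Then for $1\le r\le n$ the marginal distributions of the ordered block sizes are $$\mathbb{P}(|A_{(1)}|\le r)=\sum_{k=\lceil n/r\rceil}^n v_{n,k}B^{(r)}_{n,k}(w_\bullet),$$ $$\mathbb{P}(|A_{(i)}|\le r)=\sum_{k=1}^{i-1}v_{n,k}B_{n,k}(w_\bullet)+\sum_{k=i}^n v_{n,k}B^{(r),(i)}_{n,k}(w_\bullet),\qquad 2\le i\le n,$$ and $$\mathbb{P}(|A_{(|\Pi_n|)}|\ge r)=\sum_{k=1}^{\lfloor n/r\rfloor}v_{n,k}B_{n,k,(r)}(w_\bullet),$$ where $|A_{(i)}|=0$ if $i>|\Pi_n|$.
   Context: $[n]=\{1,\dots,n\}$. Let $(w_j)_{j\ge1}$ and $(v_{n,k})_{1\le k\le n}$ be non-negative weights. A Gibbs partition of $[n]$ with these weights is an exchangeable random partition $\Pi_n$ of $[n]$ such that each partition of $[n]$ into blocks of sizes $n_1,\dots,n_k$ has probability $v_{n,k}\prod_{j=1}^k w_{n_j}$ (the weights being such that these probabilities sum to $1$). $|\Pi_n|$ is the number of blocks and $|A_{(1)}|\ge|A_{(2)}|\ge\cdots\ge|A_{(|\Pi_n|)}|$ are the block sizes in descending order. Partial Bell polynomials and associated partial Bell polynomials: all sums are over non-negative integer sequences $(m_1,\dots,m_n)$ with $\sum_j m_j=k$ and $\sum_j jm_j=n$ and the indicated extra restriction; put $W(m)=\prod_{j=1}^n\left(\frac{w_j}{j!}\right)^{m_j}\frac1{m_j!}$.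 $B_{n,k}(w_\bullet)=n!\sum W(m)$ (no extra restriction); $B_{n,k,(r)}(w_\bullet)=n!\sum W(m)$ over $m$ with $m_j=0$ for $j<r$; $B^{(r)}_{n,k}(w_\bullet)=n!\sum W(m)$ over $m$ with $m_j=0$ for $j>r$; $B^{(r),(i)}_{n,k}(w_\bullet)=n!\sum W(m)$ over $m$ with $m_{r+1}+\cdots+m_n<i$. Empty sums are $0$. *)

(* Defs.v *)
From HB Require Import structures.
From mathcomp Require Import all_boot all_order all_fingroup all_algebra.
From mathcomp Require Import all_classical all_reals all_analysis.

Set Implicit Arguments.
Unset Strict Implicit.
Unset Printing Implicit Defensive.

Import Order.TTheory GRing.Theory Num.Theory.

Local Open Scope ring_scope.

Definition ceil_divn (n r : nat) : nat := ((n + r.-1) %/ r)%N.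

Lemma ceil_divnE (n r : nat) : (0 < r)%N ->
  (ceil_divn n r)%:Z = Num.ceil (n%:R / r%:R : rat).
Proof.
case: r => // r _; apply/esym/eqP; rewrite ceil_eq /ceil_divn /=.
rewrite ltr_pdivlMr ?ler_pdivrMr ?ltr0n // intrD -[(_%:Z)%:~R]/(_%:R).
rewrite mulrDl mulN1r ltrBlDr -!natrM -natrD ltr_nat ler_nat.
have q1 := leq_divM (n + r) r.+1.
have q2 := ltn_ceil (n + r) (ltn0Sn r).
apply/andP; split; first by rewrite addnS ltnS.
by move: q2; rewrite mulSnr addnS ltnS leq_add2r.
Qed.

Section Bell.
Context {R : realType}.

(* A sequence (m_1, ..., m_n) is encoded as m : {ffun 'I_n -> 'I_n.+1}, where
   m j stands for m_{j+1}.  Bounding the values by n loses nothing, since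
   \sum_j j m_j = n forces m_j <= n. *)
Definition bell_sum (w : nat -> R) (n k : nat)
    (C : pred {ffun 'I_n -> 'I_n.+1}) : R :=
  n`!%:R *
  \sum_(m : {ffun 'I_n -> 'I_n.+1} |
          [&& (\sum_(j < n) m j == k)%N, (\sum_(j < n) j.+1 * m j == n)%N & C m])
     \prod_(j < n) ((w j.+1 / (j.+1)`!%:R) ^+ m j / (m j)`!%:R).

(* In the usual notation:
     bell w n k            = B_{n,k}(w),
     bell_ge w r n k       = B_{n,k,(r)}(w),
     bell_le w r n k       = B^{(r)}_{n,k}(w),
     bell_few_gt w r i n k = B^{(r),(i)}_{n,k}(w). *)
Definition bell (w : nat -> R) (n k : nat) : R :=
  bell_sum w k (@predT {ffun 'I_n -> 'I_n.+1}).

Definition bell_ge (w : nat -> R) (r n k : nat) : R :=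
  bell_sum w k (fun m : {ffun 'I_n -> 'I_n.+1} =>
    [forall j : 'I_n, (j.+1 < r)%N ==> (m j == 0%N :> nat)]).

Definition bell_le (w : nat -> R) (r n k : nat) : R :=
  bell_sum w k (fun m : {ffun 'I_n -> 'I_n.+1} =>
    [forall j : 'I_n, (r < j.+1)%N ==> (m j == 0%N :> nat)]).

Definition bell_few_gt (w : nat -> R) (r i n k : nat) : R :=
  bell_sum w k (fun m : {ffun 'I_n -> 'I_n.+1} =>
    (\sum_(j < n | r < j.+1) m j < i)%N).

End Bell.

Section BlockSizes.
Context {n : nat}.
Implicit Type pi : {set {set 'I_n}}.

Definition block_sizes pi : seq nat :=
  sort geq [seq #|pred_of_set B| | B <- enum pi].

(* |A_(i)| for i >= 1 (indices start at 1); it is 0 when i > #|pi|. *)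
Definition block_size pi (i : nat) : nat := nth 0%N (block_sizes pi) i.-1.

Definition perm_partition (s : {perm 'I_n}) pi : {set {set 'I_n}} :=
  ((fun B : {set 'I_n} => s @: B) @: pi)%SET.

End BlockSizes.

Definition gibbs_prob {R : realType} (w : nat -> R) (v : nat -> nat -> R)
    (n : nat) (pi : {set {set 'I_n}}) : R :=
  v n #|pi| * \prod_(B in pi) w #|B|.

(* The ground set [n] = {1, ..., n} is represented by 'I_n. *)
Record random_partition d (T : measurableType d) (n : nat)
    (Pi : T -> {set {set 'I_n}}) : Prop := {
  random_partitionP : forall t, finset.partition (Pi t) [set: 'I_n]%SET ;
  random_partition_measurable :
    forall pi, measurable [set t | Pi t = pi]%classic }.

Definition exchangeable d (T : measurableType d) (R : realType)
    (P : probability T R) (n : nat) (Pi : T -> {set {set 'I_n}}) : Prop :=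
  forall (s : {perm 'I_n}) (pi : {set {set 'I_n}}),
    P [set t | perm_partition s (Pi t) = pi]%classic
    = P [set t | Pi t = pi]%classic.

Record gibbs_partition d (T : measurableType d) (R : realType)
    (P : probability T R) (w : nat -> R) (v : nat -> nat -> R) (n : nat)
    (Pi : T -> {set {set 'I_n}}) : Prop := {
  gibbs_random : random_partition Pi ;
  gibbs_exchangeable : exchangeable P Pi ;
  gibbs_law : forall pi : {set {set 'I_n}},
    finset.partition pi [set: 'I_n]%SET ->
    P [set t | Pi t = pi]%classic = (gibbs_prob w v pi)%:E }.

(* Main.v *)
Require Import Defs.
From HB Require Import structures.
From mathcomp Require Import all_boot all_order all_fingroup all_algebra.
From mathcomp Require Import all_classical all_reals all_analysis.

Set Implicit Arguments.
Unset Strict Implicit.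
Unset Printing Implicit Defensive.

Import Order.TTheory GRing.Theory Num.Theory.

Local Open Scope ring_scope.

(* Grouping set partitions of [n] by their type m (m_j blocks of size j), a
   partition of type m has Gibbs probability v_{n,k} \prod_j w_j^{m_j} with
   k = \sum_j m_j, and there are n! / \prod_j (j!^{m_j} m_j!) of them: this
   count follows by induction from N(n, m) = \sum_j C(n-1, j-1) N(n-j, m - e_j),
   where j is the size of the block of a fixed element.  Hence an event that
   constrains only the type has probability \sum_k v_{n,k} times a restricted
   Bell sum, and |A_(i)| <= r means that fewer than i blocks are larger than r.
   The indices k missing from the first and third sums contribute empty sums. *)

(** * Counting the set partitions of a given type *)

Section CountingPartitionsByType.
Import mathcomp.boot.finset.
Local Open Scope set_scope.
Local Open Scope nat_scope.
Variable T : finType.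
Implicit Types (A B : {set T}) (pi : {set {set T}}).

Definition blocks_of_size pi j : nat := #|[set B in pi | #|B| == j]|.

(** [N] is kept independent of [A], so that the recursion on the ground set can shrink [A] while the
    index range of the type stays fixed. *)
Definition partitions_of_type A N (m : 'I_N -> nat) : {set {set {set T}}} :=
  [set pi | partition pi A & [forall j : 'I_N, blocks_of_size pi j.+1 == m j]].

Lemma blocks_of_sizeD1 pi B j : B \in pi ->
  blocks_of_size pi j = (#|B| == j) + blocks_of_size (pi :\ B) j.
Proof.
move=> Bpi; rewrite /blocks_of_size (cardsD1 B) !inE Bpi /=; congr (_ + _).
by apply: eq_card => C; rewrite !inE andbA.
Qed.

(** Removing [x] gives a bijection onto the [j]-subsets of [A :\ x]. This counts the candidates of
    size [j.+1] for the block of [x]. *)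
Lemma card_rooted_sets A x j : x \in A ->
  #|[set B : {set T} | [&& x \in B, B \subset A & #|B| == j.+1]]|
  = 'C(#|A|.-1, j).
Proof.
move=> xA; have -> : #|A|.-1 = #|A :\ x| by rewrite (cardsD1 x A) xA.
rewrite -cards_draws -[RHS](@card_in_imset _ _ (setU [set x])); last first.
  move=> B C; rewrite !inE !subsetD1 => /andP[/andP[_ xB] _] /andP[/andP[_ xC] _].
  by move=> eqBC; rewrite -(setU1K xB) -(setU1K xC) eqBC.
apply: eq_card => B; rewrite !inE; apply/idP/imsetP => [/and3P[xB BA cB]|[C]].
  exists (B :\ x); last by rewrite setD1K.
  rewrite inE setSD //=; have := cardsD1 x B.
  by rewrite xB (eqP cB) add1n => -[<-].
rewrite inE subsetD1 => /andP[/andP[CA xC] /eqP cC] ->.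
by rewrite setU11 subUset sub1set xA CA cardsU1 xC cC eqxx.
Qed.

(** Deleting [B] is a bijection, with inverse [pi |-> B |: pi]: as [B] is nonempty, it is never
    already a block of a partition of [A :\: B]. *)
Lemma card_partitions_of_type_block A N (m : 'I_N -> nat) B (j0 : 'I_N) :
    B \subset A -> #|B| = j0.+1 -> 0 < m j0 ->
  #|[set pi in partitions_of_type A m | B \in pi]|
  = #|partitions_of_type (A :\: B) (fun j => m j - (j == j0))|.
Proof.
move=> BA cB m0.
have B0 : B != set0 by rewrite -card_gt0 cB.
have disjB pi : partition pi (A :\: B) -> B \notin pi.
  move=> pipart; apply: contraL (B0) => /(partitionS pipart).
  by rewrite subsetD => /andP[_]; rewrite -setI_eq0 setIid negbK.
have sizeB (j : 'I_N) : (#|B| == j.+1) = (j == j0).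
  by rewrite cB eqSS eq_sym.
rewrite -[RHS](@card_in_imset _ _ (fun pi => B |: pi)); last first.
  move=> pi pi'; rewrite !inE => /andP[/disjB Bpi _] /andP[/disjB Bpi' _].
  by move=> eqpi; rewrite -(setU1K Bpi) -(setU1K Bpi') eqpi.
apply: eq_card => pi; apply/idP/imsetP => [|[pi' + ->]]; rewrite !inE.
  move=> /andP[/andP[pipart /forallP mpi] Bpi]; exists (pi :\ B).
    rewrite inE partitionD1 //; apply/forallP => j.
    by rewrite -(eqP (mpi j)) (blocks_of_sizeD1 _ Bpi) sizeB addKn.
  by rewrite setD1K.
move=> /andP[pipart /forallP mpi]; rewrite eqxx andbT.
have Bpi := disjB _ pipart; apply/andP; split.
  have -> : A = B :|: (A :\: B) by rewrite -{1}(setID A B) (setIidPr BA).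
  rewrite partitionU1 // disjoints_subset; apply/fintype.subsetP => x xB.
  by rewrite !inE xB.
apply/forallP => j; rewrite (@blocks_of_sizeD1 _ B) ?setU11 // setU1K //.
rewrite (eqP (mpi j)) sizeB; case: (j =P j0) => [->|_]; last by rewrite subn0.
by rewrite subnKC.
Qed.

Lemma sum_decr_type N (f m : 'I_N -> nat) (j0 : 'I_N) : 0 < m j0 ->
  \sum_(j < N) f j * m j = f j0 + \sum_(j < N) f j * (m j - (j == j0)).
Proof.
move=> m0; rewrite (bigD1 j0) //= [in RHS](bigD1 j0) //= eqxx addnA.
rewrite -mulnS subnSK // subn0; congr (_ + _).
by apply: eq_bigr => j /negPf->; rewrite subn0.
Qed.

Lemma prod_decr_type N (m : 'I_N -> nat) (j0 : 'I_N) : 0 < m j0 ->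
  \prod_(j < N) ((j.+1)`! ^ m j * (m j)`!)
  = j0.+1`! * m j0 *
    \prod_(j < N) ((j.+1)`! ^ (m j - (j == j0)) * (m j - (j == j0))`!).
Proof.
move=> m0; rewrite (bigD1 j0) //= [in RHS](bigD1 j0) //= eqxx mulnA.
congr (_ * _); last by apply: eq_bigr => j /negPf->; rewrite subn0.
by case: (m j0) m0 => // k _; rewrite subn1 /= factS expnS mulnACA.
Qed.

(** Strong induction on [#|A|], in a form free of division. Fix [x] in [A]. By induction each
    candidate block of [x] of size s contributes (|A|-s)! s! m_s. There are C(|A|-1, s-1) of them,
    together s m_s (|A|-1)!, and summing over s gives |A| (|A|-1)!. *)
Lemma card_partitions_of_type A N (m : 'I_N -> nat) :
    #|A| <= N -> \sum_(j < N) j.+1 * m j = #|A| ->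
  #|partitions_of_type A m| * \prod_(j < N) ((j.+1)`! ^ m j * (m j)`!) = (#|A|)`!.
Proof.
elim: {A}_.+1 {-2}A (ltnSn #|A|) m => // a IH A; rewrite ltnS => cA m AN.
case: (set_0Vmem A) => [->|[x xA]].
  rewrite cards0 => /eqP; rewrite sum_nat_eq0 => /forallP /= m0.
  have {}m0 j : m j = 0 by have /eqP := m0 j; case: (m j).
  rewrite [X in _ * X]big1 ?muln1 => [|j _]; last by rewrite m0.
  rewrite (_ : partitions_of_type _ _ = [set set0]) ?cards1 //.
  apply/setP => pi; rewrite !inE partition_set0.
  case: eqP => //= ->; apply/forallP => j; rewrite m0 cards_eq0.
  by apply/eqP/setP => B; rewrite !inE.
move=> sumA; have A0 : 0 < #|A| by apply/card_gt0P; exists x.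
set D := \prod_(j < N) _.
rewrite -sum1_card (partition_big (fun pi => pblock pi x)
   (fun B : {set T} => (x \in B) && (B \subset A))) /=; last first.
  move=> pi; rewrite inE => /andP[pipart _].
  rewrite mem_pblock (cover_partition pipart) xA (partitionS pipart) //.
  by rewrite pblock_mem // (cover_partition pipart).
(* The right-hand sum has the single term [j = #|B|.-1]. Writing it as a sum allows exchanging it
   with the sum over [B]. *)
have block_term B : (x \in B) && (B \subset A) ->
    (\sum_(pi in partitions_of_type A m | pblock pi x == B) 1) * D
    = \sum_(j < N | #|B| == j.+1) (#|A| - j.+1)`! * (j.+1`! * m j).
  move=> /andP[xB BA].
  have B0 : 0 < #|B| by apply/card_gt0P; exists x.
  have BN : #|B|.-1 < N by rewrite prednK // (leq_trans (subset_leq_card BA)).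
  pose j0 := Ordinal BN.
  rewrite (big_pred1 j0) => [|j]; last first.
    by rewrite /= -(inj_eq val_inj) /= -[in RHS]eqSS prednK // eq_sym.
  rewrite (eq_bigl [in [set pi in partitions_of_type A m | B \in pi]]);
      last first.
    move=> pi; rewrite !inE.
    case pipart: (partition pi A) => //=; congr (_ && _).
    apply/eqP/idP => [<-|Bpi].
      by rewrite pblock_mem // (cover_partition pipart).
    exact: def_pblock (partition_trivIset pipart) Bpi xB.
  (* If [m j0 = 0], both sides vanish: no partition of this type has a block of the size of [B]. *)
  rewrite sum1_card /= prednK //; case: (posnP (m j0)) => m0.
    rewrite m0 !muln0; apply/eqP; rewrite muln_eq0 cards_eq0; apply/orP; left.
    apply/eqP/setP => pi; rewrite !inE; apply/negP.
    move=> /andP[/andP[_ /forallP/(_ j0)]]; rewrite m0 cards_eq0 => /eqP E Bpi.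
    by have := in_set0 B; rewrite -E inE Bpi /= prednK // eqxx.
  have cB : #|B| = j0.+1 by rewrite /= prednK.
  have cAB : #|A :\: B| = #|A| - j0.+1 by rewrite cardsD (setIidPr BA) cB.
  rewrite (card_partitions_of_type_block BA cB m0) /D (prod_decr_type m0).
  rewrite mulnCA -cB [in X in _ = X * _]cB -cAB mulnC; congr (_ * _).
  apply: IH.
  - by rewrite cAB (leq_trans _ cA) // ltn_subrL.
  - by rewrite cAB (leq_trans (leq_subr _ _)).
  - by rewrite cAB -sumA (sum_decr_type _ m0) addKn.
rewrite big_distrl /= (eq_bigr _ block_term) (exchange_big_dep predT) //=.
have -> : (#|A|)`! = (\sum_(j < N) j.+1 * m j) * (#|A|.-1)`!.
  by rewrite sumA -[in LHS](prednK A0) factS prednK.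
rewrite big_distrl /=.
apply: eq_bigr => j _.
under eq_bigl do rewrite -andbA.
rewrite sum_nat_cond_const.
rewrite (card_rooted_sets j xA).
(* A nonzero [m j] forces [j < #|A|], which [bin_fact] needs. *)
case: (posnP (m j)) => [->|mj]; first by rewrite !muln0.
have ltjA : j < #|A|.
  rewrite -sumA (bigD1 j) //= (leq_trans _ (leq_addr _ _)) //.
  exact: leq_pmulr.
have -> : #|A| - j.+1 = #|A|.-1 - j by rewrite subnS -subn1 subnAC subn1.
have lejA : j <= #|A|.-1 by rewrite -ltnS prednK.
rewrite -(bin_fact lejA) factS -!mulnA.
rewrite (mulnCA (#|A|.-1 - j)`!) (mulnCA 'C(_, _)); congr (_ * _).
by rewrite [RHS]mulnCA; congr (_ * _); rewrite mulnA mulnC (mulnC j`!).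
Qed.
End CountingPartitionsByType.

(** * From set partitions to types: the Gibbs mass of a type-determined family *)

Section BlockTypes.
Import mathcomp.boot.finset.
Variable n : nat.
Implicit Types (pi : {set {set 'I_n}}) (m : {ffun 'I_n -> 'I_n.+1}).
Let setpart pi := finset.partition pi [set: 'I_n]%SET.

(** [inord] is faithful only for values at most [n]; for set partitions this is ensured by
    [val_block_type]. *)
Definition block_type pi : {ffun 'I_n -> 'I_n.+1} :=
  [ffun j : 'I_n => inord (blocks_of_size pi j.+1)].

(** Each block is nonempty, so its size is [j.+1] for exactly one [j < n]. The operation is a
    general commutative law in order to cover both sums and products. *)
Lemma big_block_sizes (R : Type) (idx : R) (op : Monoid.com_law idx)
    (f : nat -> R) pi : setpart pi ->
  \big[op/idx]_(B in pi) f #|B|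
  = \big[op/idx]_(j < n) iter (blocks_of_size pi j.+1) (op (f j.+1)) idx.
Proof.
move=> pipart.
transitivity
  (\big[op/idx]_(B in pi) \big[op/idx]_(j < n | #|B| == j.+1) f j.+1).
  apply: eq_bigr => B Bpi.
  have B0 : (0 < #|B|)%N by rewrite card_gt0 (partition_neq0 pipart).
  have Bn : (#|B|.-1 < n)%N.
    by rewrite prednK // -[X in (_ <= X)%N](card_ord n) max_card.
  rewrite (big_pred1 (Ordinal Bn)) /= ?prednK // => j.
  by rewrite /= -(inj_eq val_inj) /= -[in RHS]eqSS prednK // eq_sym.
rewrite (exchange_big_dep predT) //=; apply: eq_bigr => j _.
by rewrite big_const /blocks_of_size cardsE.
Qed.

Lemma val_block_type pi j : setpart pi ->
  block_type pi j = blocks_of_size pi j.+1 :> nat.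
Proof.
move=> pipart; rewrite ffunE inordK // ltnS.
have : (blocks_of_size pi j.+1 <= #|pi|)%N.
  by apply: subset_leq_card; apply/fintype.subsetP => B; rewrite inE => /andP[].
move=> /leq_trans; apply.
(* There are at most [n] blocks, since the block sizes are at least 1 and add up to [n]. *)
rewrite -[X in (_ <= X)%N](card_ord n) -cardsT (card_partition pipart).
rewrite -sum1_card; apply: leq_sum => B Bpi.
by rewrite card_gt0 (partition_neq0 pipart).
Qed.

Lemma sum_block_sizes (f : nat -> nat) pi : setpart pi ->
  (\sum_(B in pi) f #|B| = \sum_(j < n) f j.+1 * block_type pi j)%N.
Proof.
move=> pipart; rewrite big_block_sizes //; apply: eq_bigr => j _.
by rewrite val_block_type // iter_addn_0.
Qed.

Lemma prod_block_sizes (R : comNzRingType) (f : nat -> R) pi : setpart pi ->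
  \prod_(B in pi) f #|B| = \prod_(j < n) f j.+1 ^+ block_type pi j.
Proof.
move=> pipart; rewrite big_block_sizes //; apply: eq_bigr => j _.
by rewrite val_block_type // iter_mulr_1.
Qed.

Lemma card_block_type pi : setpart pi ->
  (#|pi| = \sum_(j < n) block_type pi j)%N.
Proof.
move=> /(sum_block_sizes (fun=> 1%N)) sumpi.
by rewrite -sum1_card sumpi; apply: eq_bigr => j _; rewrite mul1n.
Qed.

Lemma weight_block_type pi : setpart pi ->
  (\sum_(j < n) j.+1 * block_type pi j = n)%N.
Proof.
move=> pipart; rewrite -(sum_block_sizes id pipart) -(card_partition pipart).
by rewrite cardsT card_ord.
Qed.

Lemma block_type_eq pi m : setpart pi ->
  (block_type pi == m) = 
    (pi \in partitions_of_type [set: 'I_n]%SET (fun j => m j : nat)).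
Proof.
move=> pipart; rewrite inE [X in X && _]pipart /=.
apply/eqP/forallP => [<- j|mE]; first by rewrite val_block_type.
by apply/ffunP => j; apply/val_inj; rewrite /= val_block_type // (eqP (mE j)).
Qed.

(** Both sides are reduced to the same sum over types [m]: the left by grouping partitions by type,
    the right by exchanging the sums over [k] and [m]. *)
Lemma sum_gibbs_prob (R : realType) (w : nat -> R) (v : nat -> nat -> R)
    (C : pred {ffun 'I_n -> 'I_n.+1}) :
  \sum_(pi | setpart pi && C (block_type pi)) gibbs_prob w v pi
  = \sum_(0 <= k < n.+1) v n k * bell_sum w k C.
Proof.
pose wt m := (\sum_(j < n) j.+1 * m j)%N.
pose nb m := (\sum_(j < n) m j)%N.
rewrite (partition_big block_type (fun m => (wt m == n) && C m)) /=; last first.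
  by move=> pi /andP[pipart ->]; rewrite /wt weight_block_type // eqxx.
pose term m : R := v n (nb m) * (n`!%:R *
   \prod_(j < n) ((w j.+1 / (j.+1)`!%:R) ^+ m j / (m j)`!%:R)).
transitivity (\sum_(m | (wt m == n) && C m) term m).
  apply: eq_bigr => m /andP[/eqP wtm Cm].
  have := @card_partitions_of_type _ [set: 'I_n]%SET n (fun j => m j : nat).
  rewrite cardsT card_ord => /(_ (leqnn n) wtm) cardm.
  (* Replacing n! by the number of partitions of type [m] times the product of factorials cancels
     every denominator, leaving that number times the common Gibbs probability. *)
  rewrite /term -cardm natrM natr_prod -mulrA -big_split /=.
  rewrite [X in _ * (_ * X)](eq_bigr (fun j : 'I_n => w j.+1 ^+ m j)); last first.
    move=> j _; rewrite natrM natrX exprMn exprVn.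
    have j0 : (j.+1)`!%:R ^+ m j != 0 :> R.
      by rewrite expf_neq0 // pnatr_eq0 -lt0n fact_gt0.
    have m0 : (m j)`!%:R != 0 :> R by rewrite pnatr_eq0 -lt0n fact_gt0.
    by rewrite mulrC -[X in X * _]mulrA -invfM divfK // mulf_neq0.
  rewrite mulrCA mulr_natl -sumr_const.
  apply: eq_big => [pi|pi /andP[/andP[pipart _] /eqP <-]].
    case pipart: (setpart pi); last first.
      by rewrite inE (pipart : finset.partition _ _ = false).
    rewrite -block_type_eq //=; case: eqP => [->|_]; first by rewrite Cm.
    by rewrite andbF.
  by rewrite /gibbs_prob (card_block_type pipart) prod_block_sizes.
rewrite /bell_sum.
under [RHS]eq_bigr do rewrite mulrA mulr_sumr.
rewrite big_mkord (exchange_big_dep (fun m => (wt m == n) && C m)) /=; last first.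
  by move=> k m _ /and3P[_ -> ->].
apply: eq_bigr => m /andP[/eqP wtm Cm].
(* A type meets only the index [k = nb m], which is in range because [nb m <= wt m]. *)
have nbn : (nb m < n.+1)%N.
  by rewrite ltnS -wtm; apply: leq_sum => j _; rewrite mulSn leq_addr.
rewrite (big_pred1 (Ordinal nbn)) /= => [|k]; first by rewrite /term -mulrA.
by rewrite -/(nb m) -/(wt m) wtm eqxx Cm !andbT /= -(inj_eq val_inj) eq_sym.
Qed.

End BlockTypes.

(** * Order statistics of the block sizes as counts of blocks *)

Section OrderedBlockSizes.
Import mathcomp.boot.finset.
Local Open Scope nat_scope.
Variable n : nat.
Implicit Types pi : {set {set 'I_n}}.

(** In a descending list the entries above [r] form an initial segment. The default 0 keeps the
    equivalence valid past the end, matching |A_(i)| = 0 for i > |pi|. *)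
Lemma nth_sorted_geq_le s i r : sorted geq s ->
  (nth 0 s i <= r) = (count (fun x => r < x) s <= i).
Proof.
elim: s i => [|a s IH] i /=; first by rewrite nth_nil !leq0n.
move=> as_sorted; have geq_trans : transitive geq.
  by move=> y x z yx zy; apply: leq_trans zy yx.
have le_a : {in s, forall x, x <= a}.
  by move: as_sorted; rewrite (path_sortedE geq_trans) => /andP[/allP].
case: (leqP a r) => [ar|ra] /=.
  have -> : count (fun x => r < x) s = 0.
    apply/eqP; rewrite -leqn0 leqNgt -has_count; apply/hasPn => x xs.
    by rewrite -leqNgt (leq_trans (le_a x xs)).
  rewrite leq0n; case: i => //= i.
  have [si|si] := ltnP i (size s); last by rewrite nth_default.
  by rewrite (leq_trans (le_a _ (mem_nth _ si))).
case: i => [|i] /=; last by rewrite IH ?(path_sorted as_sorted).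
by apply/negbTE; rewrite -ltnNge.
Qed.

Lemma count_block_sizes (a : pred nat) pi :
  count a (block_sizes pi) = \sum_(B in pi) a #|B|.
Proof.
rewrite /block_sizes (seq.permP (permEl (perm_sort _ _))) count_map.
by rewrite -sumn_count sumnE big_map big_enum.
Qed.

Lemma block_size_le pi i r : 0 < i ->
  (block_size pi i <= r) = (\sum_(B in pi) (r < #|B|) < i).
Proof.
move=> i0; rewrite /block_size nth_sorted_geq_le ?count_block_sizes.
  by rewrite -[in RHS](prednK i0) ltnS.
by apply: sort_sorted => x y; exact: leq_total.
Qed.

(** The smallest size exceeds [r.-1] exactly when at least [#|pi|] blocks, hence all of them, exceed
    [r.-1]. *)
Lemma smallest_block_size_ge pi r : 0 < r -> 0 < #|pi| ->
  (r <= block_size pi #|pi|) = (\sum_(B in pi) (#|B| < r) == 0).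
Proof.
case: r => // r _ pi0; rewrite ltnNge block_size_le // -leqNgt.
rewrite -[X in X <= _]sum1_card.
rewrite (eq_bigr (fun B : {set 'I_n} => (r < #|B|) + (#|B| < r.+1))) => [|B _].
  by rewrite big_split /= -[X in _ <= X]addn0 leq_add2l leqn0.
by rewrite ltnS; case: leqP.
Qed.

End OrderedBlockSizes.

(** * Comparison and vanishing of restricted Bell sums *)

Section BellSums.
Variables (R : realType) (w : nat -> R) (n : nat).
Implicit Types (m : {ffun 'I_n -> 'I_n.+1}).
Implicit Types (C : pred {ffun 'I_n -> 'I_n.+1}).

Lemma eq_bell_sum k C C' :
  (forall m, (\sum_(j < n) m j = k)%N -> (\sum_(j < n) j.+1 * m j = n)%N ->
     C m = C' m) ->
  bell_sum w k C = bell_sum w k C'.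
Proof.
move=> CC'; rewrite /bell_sum; congr (_ * _); apply: eq_bigl => m.
by case: eqP => //= mk; case: eqP => //= mn; rewrite CC'.
Qed.

Lemma bell_sum_eq0 k C :
  (forall m, (\sum_(j < n) m j = k)%N -> (\sum_(j < n) j.+1 * m j = n)%N ->
     ~~ C m) ->
  bell_sum w k C = 0.
Proof.
move=> C0; rewrite /bell_sum big_pred0 ?mulr0 // => m.
by apply/negP => /and3P[/eqP mk /eqP mn]; apply/negP/C0.
Qed.

(** With no blocks all [m j] are 0, so the weight is 0 and not [n]. *)
Lemma bell_sum0 C : (0 < n)%N -> bell_sum w 0 C = 0.
Proof.
move=> n0; apply: bell_sum_eq0 => m /eqP m0 mn.
move: n0; rewrite -mn big1 // => j _.
move: m0; rewrite sum_nat_eq0 => /forall_inP/(_ j isT)/eqP->.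
by rewrite muln0.
Qed.

Lemma bell_few_gt_full r i k : (k < i)%N -> bell_few_gt w r i n k = bell w n k.
Proof.
move=> ki; apply: eq_bell_sum => m mk _ /=.
rewrite (leq_ltn_trans _ ki) // -mk.
rewrite [X in (_ <= X)%N](bigID (fun j : 'I_n => r < j.+1)%N) /=.
exact: leq_addr.
Qed.

(** This makes the formula for the largest block the case [i = 1] of the general one. *)
Lemma bell_le_few_gt r k : bell_le w r n k = bell_few_gt w r 1 n k.
Proof.
by apply: eq_bell_sum => m _ _; rewrite ltnS leqn0 sum_nat_eq0.
Qed.

(** With [k] blocks of size at most [r], [n <= r * k]. *)
Lemma bell_le_eq0 r k : (0 < r)%N -> (k < ceil_divn n r)%N ->
  bell_le w r n k = 0.
Proof.
move=> r0 kr; apply: bell_sum_eq0 => m mk mn; apply/negP => /forallP mr.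
have : (n <= r * k)%N.
  rewrite -[X in (X <= _)%N]mn -mk big_distrr /=; apply: leq_sum => j _.
  have := mr j; case: ltnP => [_ /eqP->|jr _]; first by rewrite !muln0.
  by rewrite leq_mul2r jr orbT.
(* [k < ceil_divn n r] unfolds to [k * r + r <= n + r.-1], that is [k * r < n]. *)
move: kr; rewrite /ceil_divn leq_divRL // mulSnr leqNgt => /negP + nrk; apply.
by rewrite -addnS prednK // leq_add2r mulnC.
Qed.

(** With [k] blocks of size at least [r], [r * k <= n]. *)
Lemma bell_ge_eq0 r k : (0 < r)%N -> (n %/ r < k)%N -> bell_ge w r n k = 0.
Proof.
move=> r0 rk; apply: bell_sum_eq0 => m mk mn; apply/negP => /forallP mr.
move: rk; rewrite ltn_divLR // ltnNge => /negP; apply.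
rewrite -[X in (_ <= X)%N]mn -mk mulnC big_distrr /=; apply: leq_sum => j _.
have := mr j; case: ltnP => [_ /eqP->|jr _]; first by rewrite !muln0.
by rewrite leq_mul2r jr orbT.
Qed.

End BellSums.

(** * Probabilities of events and the three formulas *)

Lemma gibbs_event_prob (R : realType) (d : measure_display)
    (T : measurableType d) (P : probability T R) (w : nat -> R)
    (v : nat -> nat -> R) (n : nat) (Pi : T -> {set {set 'I_n}})
    (Q : pred {set {set 'I_n}}) (C : pred {ffun 'I_n -> 'I_n.+1}) :
  gibbs_partition P w v Pi ->
  (forall pi, finset.partition pi [set: 'I_n]%SET -> Q pi = C (block_type pi)) ->
  P [set t | Q (Pi t)]%classic
  = (\sum_(0 <= k < n.+1) v n k * bell_sum w k C)%:E.
Proof.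
move=> [[Pipart Pimeas] _ law] QC.
(* The event is the finite disjoint union of the fibres of [Pi] over [D]. Restricting [D] to set
   partitions loses nothing and makes the Gibbs law applicable. *)
pose D := [set pi | finset.partition pi [set: 'I_n]%SET && Q pi]%classic.
have -> : [set t | Q (Pi t)]%classic
        = (\bigcup_(pi in D) [set t | Pi t = pi])%classic.
  apply/seteqP; split=> [t Qt|t [pi /andP[_ Qpi] /= ->] //].
  by exists (Pi t) => //; rewrite /D /= Pipart.
rewrite measure_fin_bigcup //; first last.
- by move=> pi pi' _ _ [t [/= <- <-]].
- exact: finite_finset.
rewrite -(sum_gibbs_prob w v C) -sumEFin.
rewrite [RHS]bigfs ?index_enum_uniq //; last first.
  by move=> pi _; rewrite mem_index_enum.
rewrite (_ : [set` _]%classic = D).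
  by apply: eq_fsbigr => pi; rewrite inE => /andP[/law].
apply/seteqP; split=> pi /andP[pipart Qpi]; apply/andP; split=> //.
  by rewrite QC.
by rewrite -QC.
Qed.

Theorem lemma3p1 (R : realType) (d : measure_display) (T : measurableType d)
    (P : probability T R) (w : nat -> R) (v : nat -> nat -> R) (n : nat)
    (Pi : T -> {set {set 'I_n}})
    (w_ge0 : forall j : nat, (1 <= j)%N -> 0 <= w j)
    (v_ge0 : forall k : nat, (1 <= k <= n)%N -> 0 <= v n k)
    (gibbs : gibbs_partition P w v Pi)
    (r : nat) (r_bounds : (1 <= r <= n)%N) :
  [/\ P [set t | (block_size (Pi t) 1 <= r)%N]%classic
        = (\sum_(ceil_divn n r <= k < n.+1) v n k * bell_le w r n k)%:E,
      (forall i : nat, (2 <= i <= n)%N ->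
        P [set t | (block_size (Pi t) i <= r)%N]%classic
          = (\sum_(1 <= k < i) v n k * bell w n k
             + \sum_(i <= k < n.+1) v n k * bell_few_gt w r i n k)%:E)
    & P [set t | (r <= block_size (Pi t) #|Pi t|)%N]%classic
        = (\sum_(1 <= k < (n %/ r).+1) v n k * bell_ge w r n k)%:E].
Proof.
have [r0 rn] := andP r_bounds.
have n0 : (0 < n)%N := leq_trans r0 rn.
(* One formula for all [i >= 1] serves both upper-tail-count statements; it is split below at
   [ceil_divn n r] for [i = 1] and at [i] otherwise. *)
have event_le i : (0 < i)%N ->
    P [set t | (block_size (Pi t) i <= r)%N]%classic
    = (\sum_(0 <= k < n.+1) v n k * bell_few_gt w r i n k)%:E.
  move=> i0; apply: (gibbs_event_prob
    (Q := fun pi => (block_size pi i <= r)%N) gibbs) => pi pipart.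
  rewrite block_size_le // (sum_block_sizes (fun s => (r < s)%N) pipart).
  rewrite [in RHS]big_mkcond; congr (_ < _)%N; apply: eq_bigr => j _ /=.
  by case: ifP => _; rewrite ?mul1n.
split=> [|i /andP[i2 i_n]|].
- rewrite event_le //; congr (_%:E).
  have cn : (ceil_divn n r <= n.+1)%N.
    rewrite /ceil_divn -ltnS ltn_divLR // mulSnr -addnS prednK // leq_add2r.
    exact: leq_trans (leqnSn n) (leq_pmulr _ r0).
  rewrite [LHS](@big_cat_nat _ _ _ (ceil_divn n r)) //= big_nat_cond big1 ?add0r.
    by apply: eq_bigr => k _; rewrite bell_le_few_gt.
  by move=> k /andP[/andP[_ kr] _]; rewrite -bell_le_few_gt bell_le_eq0 // mulr0.
- rewrite event_le ?(ltnW i2) //; congr (_%:E).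
  rewrite (@big_cat_nat _ _ _ i) ?(leqW i_n) //=; congr (_ + _).
  (* The term [k = 0] vanishes because [n > 0]; for [0 < k < i] the restriction on large blocks is
     automatic. *)
  rewrite big_ltn ?(ltnW i2) // /bell_few_gt bell_sum0 // mulr0 add0r.
  by apply: eq_big_nat => k /andP[_ ki]; rewrite -(bell_few_gt_full w n r ki).
- rewrite (gibbs_event_prob (Q := fun pi => (r <= block_size pi #|pi|)%N)
    (C := fun m : {ffun 'I_n -> 'I_n.+1} =>
       [forall j : 'I_n, (j.+1 < r)%N ==> (m j == 0%N :> nat)]) gibbs).
    rewrite -/(bell_ge _ _ _ _).
    congr (_%:E); rewrite (@big_cat_nat _ _ _ (n %/ r).+1) ?ltnS ?leq_div //=.
    rewrite [X in _ + X]big_nat_cond [X in _ + X]big1 ?addr0.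
      by rewrite big_ltn // bell_sum0 // mulr0 add0r.
    by move=> k /andP[/andP[rk _] _]; rewrite -/(bell_ge _ _ _ _) bell_ge_eq0 // mulr0.
  move=> pi pipart.
  (* A nonempty ground set has at least one block, so a smallest block exists. *)
  have pi0 : (0 < #|pi|)%N.
    rewrite card_gt0; apply: contraTneq n0 => pi0.
    by have := card_partition pipart; rewrite pi0 big_set0 cardsT card_ord => ->.
  rewrite smallest_block_size_ge // (sum_block_sizes (fun s => (s < r)%N) pipart).
  rewrite sum_nat_eq0; apply: eq_forallb => j /=.
  by rewrite muln_eq0 eqb0 implybE.
Qed.
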